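(* For every integer $k\ge 0$ the following three identities hold. In the ring of polynomials in noncommuting indeterminates $b_1,b_2,\dots$ with integer coefficients, $$-\chi_1(k)+\sum_{\boldsymbol{\lambda} \in \mathbf{D}_k} (-1)^{\frac{k-\ell+1}{2}}\prod_{j=1}^\ell(1+b_{\lambda_j}) =-\sigma(k)+\sum_{m \in \mathcal{V}_{k-1}} (-1)^{g_{k-1}(m)}\, m+ \sum_{m \in \mathcal{V}_k} (-1)^{g_k(m)}\, m,$$ where the product is taken from left to right as $(1+b_{\lambda_1})(1+b_{\lambda_2})\cdots(1+b_{\lambda_\ell})$. Moreover, in $\mathbb{Z}$, $$-\chi_1(k)+\sum_{\boldsymbol{\lambda} \in \mathbf{D}_k} (-1)^{\frac{k-\ell+1}{2}}=-\sigma(k),$$ and $$-\chi_1(k)+\sigma(k)=\sum_{m \in \mathcal{V}_{k-1}} (-1)^{g_{k-1}(m)+\ell} + \sum_{m \in \mathcal{V}_k} (-1)^{g_k(m)+\ell}.$$ Here $\ell$ denotes the length of the sequence $\boldsymbol{\lambda}$ (respectively, of the monomial $m$).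
   Context: $\chi_1$ is the nonprincipal Dirichlet character modulo $4$: $\chi_1(k)=1$ if $k\equiv1\pmod 4$, $-1$ if $k\equiv 3\pmod 4$, and $0$ if $k$ is even. $\mathbf{D}_k$ is the set of finite integer sequences $\boldsymbol{\lambda}=[\lambda_1,\dots,\lambda_\ell]$, $\ell\ge1$, satisfying: (D1) $k\ge\lambda_1>\lambda_2>\dots>\lambda_\ell\ge2$; (D2) $\lambda_1\equiv k\pmod2$; (D3) $\lambda_j\not\equiv\lambda_{j-1}\pmod 2$ for $2\le j\le\ell$; (D4) $\lambda_\ell\equiv0\pmod 2$. (These conditions imply that $k-\ell+1$ is even.) For an integer $k\ge -1$, $\mathcal{V}_k$ is the set of monomials $m=b_{\lambda_1}b_{\lambda_2}\cdots b_{\lambda_\ell}$, $\ell\ge 1$, whose index $[\lambda_1,\dots,\lambda_\ell]$ satisfies: (V1) $k\ge\lambda_1>\lambda_2>\dots>\lambda_\ell\ge2$; (V2) $\lambda_1\equiv k\pmod 3$; (V3) $\lambda_j\not\equiv\lambda_{j+1}\pmod 3$ for $1\le j<\ell$; (V4) $\lambda_\ell\not\equiv 1\pmod 3$. For $m\in\mathcal{V}_k$ with index $[\lambda_1,\dots,\lambda_\ell]$, $g_k(m)$ is the maximum number of pairwise disjoint sets of three consecutive integers whose union is a subset of $\{-1,0,1,\dots,k\}\setminus\{\lambda_1,\dots,\lambda_\ell\}$. $\sigma(k)=\frac{2\sqrt3}{3}\sin\left(\frac{k\pi}{3}\right)$, the 6-periodic sequence $0,1,1,0,-1,-1,\dots$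 for $k=0,1,2,\dots$. *)

(* Defs.v *)
From mathcomp Require Import all_boot all_order all_algebra.
From mathcomp Require Import finmap zify ring.
From mathcomp.multinomials Require Import monalg.
From mathcomp Require Import reals trigo.

Set Implicit Arguments.
Unset Strict Implicit.
Unset Printing Implicit Defensive.

Import Order.TTheory GRing.Theory Num.Theory.

Local Open Scope ring_scope.

Definition chi1 (k : nat) : int :=
  if (k %% 4 == 1)%N then 1 else if (k %% 4 == 3)%N then -1 else 0.

(* The integer-valued form of 2 sqrt(3) / 3 * sin (k pi / 3); see sigmaE. *)
Definition sigma (k : nat) : int := nth 0 [:: 0; 1; 1; 0; -1; -1] (k %% 6).

Section SigmaSin.
Variable R : realType.

Let a : R := pi / 3.
Let three_neq0 : 3 != 0 :> R. Proof. by rewrite pnatr_eq0. Qed.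

Let aM3 : a *+ 3 = pi.
Proof. by rewrite -[LHS]mulr_natr divfK. Qed.

Let sin2a : sin (a *+ 2) = sin a.
Proof.
have -> : a *+ 2 = - a + pi by rewrite -aM3; ring.
by rewrite sinDpi sinN opprK.
Qed.

Let sin_a_gt0 : 0 < sin a.
Proof.
apply: sin_gt0_pi; have p0 := pi_gt0 R.
by rewrite divr_gt0 //= ltr_pdivrMr // ltr_pMr // ltr1n.
Qed.

Let sin_a : 2 * sin a = Num.sqrt 3.
Proof.
have cos_a : 2 * cos a = 1.
  apply: (mulIf (lt0r_neq0 sin_a_gt0)).
  by rewrite mul1r -{2}sin2a sin_mulr2n; ring.
apply/eqP; rewrite -(@eqrXn2 _ 2) ?mulr_ge0 ?sqrtr_ge0 ?(ltW sin_a_gt0) //.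
rewrite sqr_sqrtr // exprMn sin2cos2.
have -> : 2 ^+ 2 * (1 - cos a ^+ 2) = 4 - (2 * cos a) ^+ 2 by ring.
by rewrite cos_a; apply/eqP; ring.
Qed.

Lemma sigmaE (k : nat) :
  (sigma k)%:~R = 2 * Num.sqrt 3 / 3 * sin (k%:R * pi / 3) :> R.
Proof.
pose f (n : nat) : R := 2 * Num.sqrt 3 / 3 * sin (n%:R * pi / 3).
have f1 : 2 * Num.sqrt 3 / 3 * sin a = 1.
  have -> : 2 * Num.sqrt 3 / 3 * sin a = Num.sqrt 3 * (2 * sin a) / 3 by ring.
  by rewrite sin_a -expr2 sqr_sqrtr // divff.
have f3 n : f (n + 3)%N = - f n.
  rewrite /f natrD (_ : _ * pi / 3 = n%:R * pi / 3 + pi); last by field.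
  by rewrite sinDpi mulrN.
have s3 n : sigma (n + 3) = - sigma n.
  rewrite /sigma -modnDml; have := ltn_pmod n (isT : (0 < 6)%N).
  by move: (n %% 6)%N => [|[|[|[|[|[|]]]]]].
rewrite -/(f k) (divn_eq k 3) addnC; have := ltn_pmod k (isT : (0 < 3)%N).
move: (k %% 3)%N => r r3; elim: (k %/ 3)%N => [|q IH]; last first.
  by rewrite mulSnr addnA s3 f3 mulrNz IH.
rewrite mul0n addn0 /f; case: r r3 => [|[|[|//]]] _.
- by rewrite !mul0r sin0 mulr0.
- by rewrite mul1r f1.
- by rewrite (_ : 2 * pi / 3 = a *+ 2) ?sin2a ?f1 // /a; ring.
Qed.

End SigmaSin.

(* Index sequences have entries at least 2, so they are taken in [seq nat].
   [sorted] compares adjacent entries only, also for the congruence tests. *)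

Definition inD (k : nat) (s : seq nat) : bool :=
  [&& (0 < size s)%N,
      [&& (head 0%N s <= k)%N, sorted gtn s & (2 <= last 0%N s)%N],
      (head 0%N s == k %[mod 2])%N,
      sorted (fun x y => (y != x %[mod 2])%N) s
    & (last 0%N s == 0 %[mod 2])%N].

Definition inV (k : int) (s : seq nat) : bool :=
  [&& (0 < size s)%N,
      [&& (head 0%N s)%:Z <= k, sorted gtn s & (2 <= last 0%N s)%N],
      ((head 0%N s)%:Z == k %[mod 3])%Z,
      sorted (fun x y => (x != y %[mod 3])%N) s
    & (last 0%N s != 1 %[mod 3])%N].

(* All subsequences of n, n - 1, ..., 2. *)
Definition decr_seqs (n : nat) : {fset seq nat} :=
  [fset mask (val t) (rev (iota 2 n.-1)) | t in {: n.-1.-tuple bool}]%fset.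

Definition Dset (k : nat) : {fset seq nat} :=
  [fset s in decr_seqs k | inD k s]%fset.

(* Elements of V_k are represented by their index sequences, which determine
   the monomials; V_k is empty for k < 2. *)
Definition Vset (k : int) : {fset seq nat} :=
  [fset s in decr_seqs `|k|%N | inV k s]%fset.

Lemma mem_decr_seqs (n : nat) (s : seq nat) :
  (0 < size s)%N -> (head 0%N s <= n)%N -> sorted gtn s -> (2 <= last 0%N s)%N ->
  s \in decr_seqs n.
Proof.
case: s => [//|x s] _ /= xn ps ls.
have bnd (t : seq nat) z :
    path gtn z t -> {in z :: t, forall y, last z t <= y <= z}%N.
  elim: t z => [|w t IH] z /=; first by move=> _ y /[1!inE] /eqP->; lia.
  case/andP=> wz /IH {}IH y; rewrite inE => /predU1P[->|/IH]; last by lia.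
  by have := IH w (mem_head w t); lia.
have sub y : y \in x :: s -> (2 <= y <= n)%N by move/(bnd _ _ ps); lia.
pose D := rev (iota 2 n.-1).
have -> : x :: s = filter (mem (x :: s)) D.
  apply: (irr_sorted_eq (leT := gtn)) => //.
  - exact: rev_trans ltn_trans.
  - exact: ltnn.
  - apply: sorted_filter; first exact: rev_trans ltn_trans.
    by rewrite rev_sorted iota_ltn_sorted.
  - move=> y; rewrite mem_filter mem_rev mem_iota /=.
    case: (boolP (y \in x :: s)) => //= /sub; lia.
have szm : size [seq y \in x :: s | y <- D] == n.-1.
  by rewrite size_map size_rev size_iota.
by apply/imfsetP; exists (Tuple szm) => //=; rewrite filter_mask.
Qed.

Lemma in_Dset (k : nat) (s : seq nat) : (s \in Dset k) = inD k s.
Proof.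
rewrite !inE andb_idl // => /and5P[s0 /and3P[]]; move=> *.
exact: mem_decr_seqs.
Qed.

Lemma in_Vset (k : int) (s : seq nat) : (s \in Vset k) = inV k s.
Proof.
rewrite !inE andb_idl // => /and5P[s0 /and3P[hk]]; move=> *.
by apply: mem_decr_seqs => //; rewrite -lez_nat (le_trans hk) // lez_abs.
Qed.

Definition triple (a : int) : {fset int} := [fset a; (a + 1)%R; (a + 2)%R]%fset.

(* {-1, 0, ..., k} minus the entries of s. *)
Definition gap_set (k : int) (s : seq nat) : {fset int} :=
  [fset x in [seq (i%:Z - 1)%R | i <- iota 0 `|(k + 2)%R|%N] | x \notin map Posz s]%fset.

Lemma in_gap_set (k : int) (s : seq nat) (x : int) : -1 <= k ->
  (x \in gap_set k s) = (-1 <= x <= k) && (x \notin map Posz s).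
Proof.
move=> k1; rewrite !inE /=; congr (_ && _).
apply/mapP/idP => [[i]|xk]; first by rewrite mem_iota => ik ->; lia.
by exists `|(x + 1)%R|%N; [rewrite mem_iota; lia | lia].
Qed.

Definition gap_triples (k : int) (s : seq nat) : {fset {fset int}} :=
  [fset triple a | a in gap_set k s & (triple a `<=` gap_set k s)%fset]%fset.

(* The maximal size of a set of pairwise disjoint triples. *)
Definition g (k : int) (s : seq nat) : nat :=
  \max_(P <- fpowerset (gap_triples k s) | trivIfset P) #|` P|.

(* Integer polynomials in noncommuting b_1, b_2, ...: the algebra over int of
   the free monoid on nat, where generator number n stands for b_(n+1).
   Hence [b i] is meant for i > 0 only. *)
Notation ncpoly := {malg int[{fmonom nat}]}.

Definition b (i : nat) : ncpoly := << fmu i.-1 >>.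

(* Main.v *)
Require Import Defs.
From mathcomp Require Import all_boot all_order all_algebra finmap.
From mathcomp Require Import zify.
From mathcomp.multinomials Require Import monalg.

Import Order.TTheory GRing.Theory Num.Theory.
Local Open Scope ring_scope.

Set Implicit Arguments.
Unset Strict Implicit.
Unset Printing Implicit Defensive.

(** Both sides of the polynomial identity make sense for any family [w] of
    elements of a ring in place of the indeterminates, and both satisfy
      [X_(k+2) = (1 + w_(k+2)) X_(k+1) - X_k]
    with [X_0 = 0] and [X_1 = -1]; so they agree ([Dsum_Vsum]).  Taking for [w]
    the indeterminates gives the first identity.  Taking [w = 0] kills the sums
    over V and gives the second; taking [w = -1] kills the sum over D and gives
    the third.

    Each recurrence comes from sorting the index sequences by their first entry.
    A sequence of [D_(k+2)] that does not start with [k+2] lies in [D_k]; after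
    a first entry [k+2] comes either nothing or a sequence of [D_(k+1)].  The
    sequence [k+2] alone accounts for the term [- chi1 (k+1)] ([chi1S]), which
    gives [Dsum_step].

    A sequence of [V_(k+2)] that does not start with [k+2] lies in [V_(k-1)];
    after a first entry [k+2] comes nothing, or a sequence of [V_(k+1)] or of
    [V_k].  The sequence [k+2] alone accounts for [- sigma (k+1)] ([sigmaS]).
    Hence, if [B_k] is the right-hand side of the identity,
      [V_(k+2) + V_(k-1) = w_(k+2) B_(k+1)]   ([Vsum_step]),
    and the recurrence for [B] follows since
    [sigma (k+2) - sigma (k+1) + sigma k = 0].

    The signs in [Vsum_step] need three facts on the packing number [g].  Three
    free integers on top of the range add exactly one triple ([g_add3]): any
    triple that meets [k-2, k-1, k] contains [k-2], so a packing has at most one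
    of them, and it may be exchanged for the top triple.  A used top integer may
    be discarded ([g_cons]).  Finally, the free integers above the first entry
    [h] are packed on their own, so a range whose top is congruent to [h] modulo
    3 may be raised by one without changing [g] ([g_shift]). *)

(** * Packing triples into the gaps *)

Lemma mem_triple (a x : int) : (x \in triple a) = (a <= x <= a + 2).
Proof. by rewrite !inE; lia. Qed.

(** The value [-2], where the range is empty, serves as the base of inductions
    that lower [k] by three. *)
Lemma mem_gap_set (k : int) (s : seq nat) (x : int) : -2 <= k ->
  (x \in gap_set k s) = (-1 <= x <= k) && (x \notin map Posz s).
Proof.
move=> k2; have [|k1] := leP (-1) k; first exact: in_gap_set.
have -> : k = -2 by lia.
by rewrite !inE /=; lia.
Qed.

Lemma gap_triplesP (k : int) (s : seq nat) (X : {fset int}) : -2 <= k ->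
  reflect (exists2 a, X = triple a & {in triple a, forall x, x \in gap_set k s})
    (X \in gap_triples k s).
Proof.
move=> k2; apply: (iffP idP) => [/imfsetP[a /=]|[a -> sub]].
  by rewrite !inE => /andP[_ /fsubsetP sub] ->; exists a.
apply/imfsetP; exists a => //=; rewrite inE /= sub ?mem_triple; last by lia.
exact/fsubsetP.
Qed.

Lemma g_ge (k : int) (s : seq nat) (P : {fset {fset int}}) :
  {subset P <= gap_triples k s} -> trivIfset P -> (#|` P| <= g k s)%N.
Proof.
by move=> sub tP; apply: leq_bigmax_seq => //; rewrite fpowersetE; apply/fsubsetP.
Qed.

Lemma g_le (k : int) (s : seq nat) (n : nat) :
    (forall P : {fset {fset int}}, {subset P <= gap_triples k s} ->
       trivIfset P -> (#|` P| <= n)%N) ->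
  (g k s <= n)%N.
Proof.
move=> H; apply/bigmax_leqP_seq => P; rewrite fpowersetE => /fsubsetP.
exact: H.
Qed.

Lemma trivIfset_sub (T : choiceType) (P Q : {fset {fset T}}) :
  {subset P <= Q} -> trivIfset Q -> trivIfset P.
Proof.
by move=> sub /trivIfsetP tQ; apply/trivIfsetP => A B /sub AQ /sub; exact: tQ.
Qed.

(** A triple inside the range that meets [k - 2, k - 1, k] contains [k - 2], so
    disjoint triples include at most one such; removing it leaves a packing of
    the range up to [k - 3], and conversely the top triple extends any of those. *)
Lemma g_add3 (k : int) (s : seq nat) :
  1 <= k -> {in s, forall i : nat, i%:Z <= k - 3} -> g k s = (g (k - 3) s).+1.
Proof.
move=> k1 sk; have k2 : -2 <= k by lia.
have k3 : -2 <= k - 3 by lia.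
have free x : k - 3 < x -> x \notin map Posz s.
  by move=> kx; apply/mapP => -[i /sk ik xi]; lia.
have sub3 : {subset gap_triples (k - 3) s <= gap_triples k s}.
  move=> X /(gap_triplesP _ _ k3)[a -> sub]; apply/gap_triplesP => //.
  exists a => // x /sub; rewrite !mem_gap_set //; lia.
have topP : triple (k - 2) \in gap_triples k s.
  apply/gap_triplesP => //; exists (k - 2) => // x; rewrite mem_triple => xk.
  by rewrite mem_gap_set // free ?andbT; lia.
apply/eqP; rewrite eqn_leq; apply/andP; split.
  apply: g_le => P sub tP.
  (* Inside the range, a triple that misses [k - 2] ends at most at [k - 3]. *)
  have low X : X \in P -> (k - 2)%R \notin X -> X \in gap_triples (k - 3) s.
    move=> /sub/gap_triplesP-/(_ k2)[a -> suba]; rewrite mem_triple => ka.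
    apply/gap_triplesP => //; exists a => // x xa.
    have := suba x xa; have := suba (a + 2); move: xa.
    rewrite !mem_triple !mem_gap_set //; lia.
  case: (boolP (has (fun X : {fset int} => (k - 2)%R \in X) P))
      => [/hasP[X XP kX]|/hasPn noX].
    rewrite (cardfsD1 X) XP ltnS g_ge //; last first.
      by apply: trivIfset_sub tP => Y; rewrite in_fsetD1 => /andP[].
    move=> Y; rewrite in_fsetD1 => /andP[YX YP]; apply: low => //.
    move/trivIfsetP: tP => /(_ Y X YP XP YX) /fdisjointP/(_ (k - 2)%R) disj.
    by apply: contraL kX.
  by apply: leqW; apply: g_ge => // X XP; apply: low => //; exact: noX.
have addT P : {subset P <= gap_triples (k - 3) s} -> trivIfset P ->
    (#|` P| < g k s)%N.
  move=> sub tP.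
  have disj X : X \in P -> [disjoint triple (k - 2) & X]%fset.
    move=> /sub/(gap_triplesP _ _ k3)[a -> suba]; apply/fdisjointP => x.
    rewrite !mem_triple; have := suba (a + 2).
    by rewrite mem_triple mem_gap_set //; lia.
  have TP : triple (k - 2) \notin P.
    by apply/negP => /disj/fdisjointP/(_ (k - 2)); rewrite mem_triple; lia.
  have -> : (#|` P|.+1 = #|` (triple (k - 2) |` P)%fset|)%N by rewrite cardfsU1 TP.
  apply: g_ge => [X|].
    by rewrite in_fset1U => /predU1P[->//|/sub/sub3].
  apply/trivIfsetP => X Y; rewrite !in_fset1U.
  move=> /predU1P[->|XP] /predU1P[->|YP]; rewrite ?eqxx // => XY.
  - exact: disj.
  - by rewrite fdisjoint_sym disj.
  - by move/trivIfsetP: tP; apply.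
(* Positivity makes the predecessor in the last bound exact. *)
have g0 : (0 < g k s)%N.
  apply: leq_ltn_trans (addT fset0 _ _) => //; apply/trivIfsetP => X.
  by rewrite inE.
by rewrite -(prednK g0) ltnS; apply: g_le => P sub tP; have := addT P sub tP; lia.
Qed.

Lemma g_nil (k : int) : -2 <= k -> g k [::] = (`|(k + 2)%R| %/ 3)%N.
Proof.
move=> k2; have -> : k = `|(k + 2)%R|%N%:Z - 2 by lia.
move: `|_|%N => n {k k2}; elim/ltn_ind: n => n IH.
have [n3|n3] := ltnP n 3; last first.
  rewrite g_add3 //; last by lia.
  rewrite (_ : n%:Z - 2 - 3 = (n - 3)%N%:Z - 2); last by lia.
  by rewrite IH; lia.
transitivity 0%N; last by lia.
apply/eqP; rewrite -leqn0; apply: g_le => P sub _; rewrite leqn0 cardfs_eq0.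
apply/eqP/fsetP => X; rewrite in_fset0; apply/negP => /sub/gap_triplesP-[|a _ suba]; first by lia.
have := suba a; have := suba (a + 2); rewrite !mem_triple !mem_gap_set; lia.
Qed.

Lemma g_cons (k : nat) (s : seq nat) : (0 < k)%N -> g k (k :: s) = g (k%:Z - 1) s.
Proof.
move=> k0; have E : gap_set k (k :: s) = gap_set (k%:Z - 1) s.
  apply/fsetP => x; rewrite !mem_gap_set /=; [|lia..].
  by rewrite in_cons; have [|] := boolP (x \in map Posz s); lia.
by rewrite /g /gap_triples E.
Qed.

(** The new top integer [n + 1] has the used integer [n] just below it, so no
    triple can contain it. *)
Lemma g_top (n : nat) (s : seq nat) :
  n \in s -> {in s, forall i, (i <= n)%N} -> g (n%:Z + 1) s = g n s.
Proof.
move=> ns sn; rewrite /g.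
have -> // : gap_triples (n%:Z + 1) s = gap_triples n s.
have out : n%:Z \in map Posz s by apply: map_f.
apply/fsetP => X; apply/gap_triplesP/gap_triplesP; first by lia.
- lia.
- case=> a -> suba; exists a => // x xa; move: (suba x xa) (suba n%:Z) (suba (a + 2)).
  by move: xa; rewrite !mem_triple !mem_gap_set ?out; lia.
- by case=> a -> suba; exists a => // x /suba; rewrite !mem_gap_set; lia.
Qed.

(** The [k - h] free integers above [h] are a multiple of three, so one more does
    not make room for a new triple. *)
Lemma g_shift (k : nat) (s : seq nat) (h : nat) :
    h \in s -> {in s, forall i, (i <= h)%N} -> (h <= k)%N -> h = k %[mod 3] ->
  g (k%:Z + 1) s = g k s.
Proof.
move=> hs sh; elim/ltn_ind: k => k IH hk hk3.
have [|hk'] := leqP k h; first by move=> kh; rewrite (_ : k = h) ?g_top //; lia.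
have {}hk : (h + 3 <= k)%N by lia.
rewrite [LHS]g_add3 ?[RHS]g_add3; try (move=> i /sh; lia); try lia.
have -> : k%:Z + 1 - 3 = (k - 3)%N%:Z + 1 by lia.
have -> : k%:Z - 3 = (k - 3)%N by lia.
by rewrite IH; lia.
Qed.

(** * Sorting index sequences by their first entry *)

(** An entry following [k + 2] is smaller and of the opposite parity, which is the
    condition on the first entry of an element of [D_(k+1)].  A first entry other
    than [k + 2] is at most [k], by parity. *)
Lemma inD_step (k : nat) (s : seq nat) :
  inD k.+2 s = [|| inD k s, (s == [:: k.+2]) && ~~ odd k
                 | (head 0%N s == k.+2) && inD k.+1 (behead s)].
Proof.
case: s => [|x [|y s]]; rewrite /inD //= ?eqseq_cons /= ?andbF ?orbF ?andbT.
  by lia.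
by case: (path _ y _); case: (path _ y _); rewrite ?andbF //=; lia.
Qed.

(** An entry following [k + 2] is not congruent to it modulo 3: either it is
    congruent to [k + 1], or it is congruent to [k] and then at most [k].  A first
    entry other than [k + 2] is at most [k - 1], being congruent to [k + 2]. *)
Lemma inV_step (k : nat) (s : seq nat) :
  inV k.+2 s = [|| inV (k%:Z - 1) s, (s == [:: k.+2]) && (k %% 3 != 2)%N,
                   (head 0%N s == k.+2) && inV k.+1 (behead s)
                 | (head 0%N s == k.+2) && inV k (behead s)].
Proof.
case: s => [|x [|y s]]; rewrite /inV //= ?eqseq_cons /= ?andbF ?orbF ?andbT.
  by lia.
by case: (path _ y _); case: (path _ y _); rewrite ?andbF //=; lia.
Qed.

Lemma mem_map_cons (n : nat) (l : seq (seq nat)) (s : seq nat) :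
  (s \in map (cons n.+1) l) = (head 0%N s == n.+1) && (behead s \in l).
Proof.
apply/mapP/andP => [[t tl ->]|[]]; first by rewrite /= eqxx.
by case: s => //= x s /eqP-> sl; exists s.
Qed.

Lemma big_Dset_step (M : nmodType) (F : seq nat -> M) (k : nat) :
  \sum_(s <- Dset k.+2) F s =
    \sum_(s <- Dset k) F s + \sum_(s <- Dset k.+1) F (k.+2 :: s)
    + (if odd k then 0 else F [:: k.+2]).
Proof.
pose top := if odd k then [::] else [:: [:: k.+2]].
have -> : (if odd k then 0 else F [:: k.+2]) = \sum_(s <- top) F s.
  by rewrite /top; case: odd; rewrite ?big_nil ?big_seq1.
have mem_top s : (s \in top) = (s == [:: k.+2]) && ~~ odd k.
  by rewrite /top; case: odd; rewrite inE ?andbT ?andbF.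
rewrite -(big_map (cons k.+2) predT) -!big_cat /=; apply/perm_big/uniq_perm.
- exact: fset_uniq.
- rewrite !cat_uniq fset_uniq map_inj_uniq ?fset_uniq; last by move=> ? ? [].
  have -> : uniq top by rewrite /top; case: odd.
  rewrite /= !andbT; apply/andP; split; apply/hasPn => s.
    rewrite mem_map_cons in_Dset => /andP[/eqP sk _].
    by apply/negP; rewrite /= in_Dset /inD sk => /and5P[_ /and3P[]]; lia.
  rewrite mem_top /= mem_cat mem_map_cons !in_Dset => /andP[/eqP-> _] /=.
  by rewrite /inD /= andbF orbF; lia.
- by move=> s; rewrite !mem_cat mem_map_cons mem_top !in_Dset inD_step orbAC orbA.
Qed.

Lemma big_Vset_step (M : nmodType) (F : seq nat -> M) (k : nat) :
  \sum_(s <- Vset k.+2) F s =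
    \sum_(s <- Vset (k%:Z - 1)) F s + \sum_(s <- Vset k.+1) F (k.+2 :: s)
    + \sum_(s <- Vset k) F (k.+2 :: s)
    + (if (k %% 3 == 2)%N then 0 else F [:: k.+2]).
Proof.
pose top := if (k %% 3 == 2)%N then [::] else [:: [:: k.+2]].
have -> : (if (k %% 3 == 2)%N then 0 else F [:: k.+2]) = \sum_(s <- top) F s.
  by rewrite /top; case: eqP; rewrite ?big_nil ?big_seq1.
have mem_top s : (s \in top) = (s == [:: k.+2]) && (k %% 3 != 2)%N.
  by rewrite /top; case: eqP; rewrite inE ?andbT ?andbF.
rewrite -!(big_map (cons k.+2) predT) -!big_cat /=; apply/perm_big/uniq_perm.
- exact: fset_uniq.
- rewrite !cat_uniq fset_uniq !map_inj_uniq ?fset_uniq; try by move=> ? ? [].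
  have -> : uniq top by rewrite /top; case: eqP.
  rewrite /= !andbT -andbA; apply/and3P; split; apply/hasPn => s.
  + rewrite mem_map_cons in_Vset => /andP[/eqP sk _].
    by apply/negP; rewrite /= in_Vset /inV sk => /and5P[_ /and3P[]]; lia.
  + rewrite mem_map_cons in_Vset => /andP[/eqP sk /and5P[_ _ /eqP s3 _ _]].
    apply/negP; rewrite /= mem_cat mem_map_cons !in_Vset.
    case/orP=> [/and5P[_ /and3P[]]|/andP[_ /and5P[_ _ /eqP]]]; first by lia.
    by lia.
  + rewrite mem_top /= !mem_cat !mem_map_cons !in_Vset => /andP[/eqP-> _] /=.
    by rewrite /inV /= !andbF !orbF; lia.
- move=> s; rewrite !mem_cat !mem_map_cons mem_top !in_Vset inV_step.
  by case: (inV _ _); rewrite //= orbC.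
Qed.

(** * Bounds on index sequences *)

(** This bound makes the truncated difference [k - size s] an honest one, so
    that the sign changes when [k] grows by two. *)
Lemma inD_size (k : nat) (s : seq nat) : inD k s -> (size s < k)%N.
Proof.
case: s => // x s /and5P[_ /and3P[/= xk xs s2] _ _ _].
suff : (size s + last x s <= x)%N by lia.
elim: s x xs {xk s2} => [|y s IH] x //= /andP[yx /IH]; lia.
Qed.

Lemma inV_bounds (k : int) (s : seq nat) : inV k s ->
  [/\ head 0%N s \in s, {in s, forall i, (i <= head 0%N s)%N}
    & {in s, forall i : nat, i%:Z <= k}].
Proof.
case: s => // x s /and5P[_ /and3P[/= xk xs _] _ _ _].
have sx : {in x :: s, forall i, (i <= x)%N}.
  move=> i; rewrite inE => /predU1P[->//|].
  by move/allP: (order_path_min (rev_trans ltn_trans) xs) => /[apply]; apply: ltnW.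
by split=> [||i /sx]; [exact: mem_head | exact: sx | lia].
Qed.

Lemma Dset_small (k : nat) : (k < 2)%N -> Dset k = fset0.
Proof.
move=> k2; apply/fsetP => s; rewrite in_Dset in_fset0; apply/negP.
by move=> sD; have := inD_size sD; case/andP: sD; lia.
Qed.

Lemma Vset_small (k : int) : k < 2 -> Vset k = fset0.
Proof.
move=> k2; apply/fsetP => s; rewrite in_Vset in_fset0; apply/negP => sV.
have [_ sh _] := inV_bounds sV; case: s sV sh => // x s.
by case/and5P=> _ /and3P[/= xk _ ls] _ _ _ /(_ _ (mem_last x s)) /= sx; lia.
Qed.

(** * The two periodic sequences *)

Lemma chi1SS (k : nat) : chi1 k.+2 = - chi1 k.
Proof.
rewrite /chi1 -(addn2 k) -modnDml; have := ltn_pmod k (isT : (0 < 4)%N).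
by move: (k %% 4)%N => [|[|[|[|]]]].
Qed.

(** The right-hand side is the contribution to the signs of [D_(k+2)] of the
    one-term sequence [[:: k.+2]], which belongs to it for [k] even. *)
Lemma chi1S (k : nat) :
  - chi1 k.+1 = if odd k then 0 else (-1) ^+ (k %/ 2).+1.
Proof.
rewrite [in RHS](divn_eq k 4) /chi1 -(addn1 k) -modnDml.
have := ltn_pmod k (isT : (0 < 4)%N); move: (k %% 4)%N (k %/ 4)%N => r q r4.
rewrite oddD oddM andbF /= (_ : (q * 4 + r) %/ 2 = 2 * q + r %/ 2)%N; last by lia.
rewrite -addnS exprD exprM sqrrN !expr1n mul1r.
by case: r r4 => [|[|[|[|]]]].
Qed.

Lemma sigmaSS (k : nat) : sigma k.+2 = sigma k.+1 - sigma k.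
Proof.
rewrite /sigma -(addn2 k) -(addn1 k) -(modnDml k 2) -(modnDml k 1).
have := ltn_pmod k (isT : (0 < 6)%N).
by move: (k %% 6)%N => [|[|[|[|[|[|]]]]]].
Qed.

(** The right-hand side is the contribution to the signs of [V_(k+2)] of the
    one-term sequence [[:: k.+2]], which belongs to it unless [k + 2 = 1] modulo
    3; the free range [-1, ..., k + 1] has [k + 3] elements. *)
Lemma sigmaS (k : nat) :
  - sigma k.+1 = if (k %% 3 == 2)%N then 0 else (-1) ^+ (k %/ 3).+1.
Proof.
rewrite [in RHS](divn_eq k 6) /sigma -(addn1 k) -modnDml.
have := ltn_pmod k (isT : (0 < 6)%N); move: (k %% 6)%N (k %/ 6)%N => r q r6.
rewrite (_ : (q * 6 + r) %/ 3 = 2 * q + r %/ 3)%N; last by lia.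
rewrite (_ : (q * 6 + r) %% 3 = r %% 3)%N; last by lia.
rewrite -addnS exprD exprM sqrrN !expr1n mul1r.
by case: r r6 => [|[|[|[|[|[|]]]]]].
Qed.

(** * The common recurrence *)

Section Continuants.
Variables (R : pzRingType) (w : nat -> R).

Definition Dsum (k : nat) : R :=
  - (chi1 k)%:~R
  + \sum_(s <- Dset k)
      (-1) ^+ ((k - size s + 1) %/ 2)%N * \prod_(i <- s) (1 + w i).

Definition Vsum (k : int) : R :=
  \sum_(s <- Vset k) (-1) ^+ g k s * \prod_(i <- s) w i.

Lemma Dsum_step (k : nat) : Dsum k.+2 = (1 + w k.+2) * Dsum k.+1 - Dsum k.
Proof.
rewrite /Dsum big_Dset_step chi1SS mulrNz opprK.
set S1 := (X in _ * (_ + X)); set S0 := (X in - (_ + X)).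
have -> : \sum_(s <- Dset k) (-1) ^+ ((k.+2 - size s + 1) %/ 2)%N
            * \prod_(i <- s) (1 + w i) = - S0.
  rewrite -sumrN big_seq [RHS]big_seq; apply: eq_bigr => s.
  rewrite in_Dset => /inD_size sk.
  have half2 n : (n < k -> (k.+2 - n + 1) %/ 2 = ((k - n + 1) %/ 2).+1)%N by lia.
  by rewrite half2 // exprS mulN1r mulNr.
have -> : \sum_(s <- Dset k.+1) (-1) ^+ ((k.+2 - size (k.+2 :: s) + 1) %/ 2)%N
            * \prod_(i <- k.+2 :: s) (1 + w i) = (1 + w k.+2) * S1.
  rewrite big_distrr; apply: eq_bigr => s _.
  by rewrite /= subSS big_cons !mulrA commr_sign.
have -> : (if odd k then 0
           else (-1) ^+ ((k.+2 - size [:: k.+2] + 1) %/ 2)%N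
                  * \prod_(i <- [:: k.+2]) (1 + w i))
          = (1 + w k.+2) * - (chi1 k.+1)%:~R.
  rewrite -mulrNz chi1S; case: ifP => _; rewrite ?mulr0 // big_seq1.
  rewrite rmorphXn rmorphN1 /= commr_sign; congr (_ ^+ _ * _); lia.
rewrite mulrDr opprD opprK.
by rewrite -[in LHS]addrA [LHS]addrA [LHS]addrC [X in X + _ = _]addrC.
Qed.

Lemma Vsum_step (k : nat) :
  Vsum k.+2 = w k.+2 * (- (sigma k.+1)%:~R + Vsum k + Vsum k.+1) - Vsum (k%:Z - 1).
Proof.
rewrite [Vsum k.+2]/Vsum big_Vset_step.
have -> : \sum_(s <- Vset (k%:Z - 1)) (-1) ^+ g k.+2 s * \prod_(i <- s) w i
          = - Vsum (k%:Z - 1).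
  rewrite -sumrN big_seq [RHS]big_seq; apply: eq_bigr => s.
  rewrite in_Vset => /inV_bounds[_ _ sk].
  rewrite g_add3 => [|//|i /sk]; [|lia].
  rewrite (_ : k.+2%:Z - 3 = k%:Z - 1); last by lia.
  by rewrite exprS mulN1r mulNr.
have -> : \sum_(s <- Vset k.+1) (-1) ^+ g k.+2 (k.+2 :: s)
            * \prod_(i <- k.+2 :: s) w i = w k.+2 * Vsum k.+1.
  rewrite big_distrr; apply: eq_bigr => s _.
  rewrite g_cons // (_ : k.+2%:Z - 1 = k.+1); last by lia.
  by rewrite /= big_cons !mulrA commr_sign.
have -> : \sum_(s <- Vset k) (-1) ^+ g k.+2 (k.+2 :: s)
            * \prod_(i <- k.+2 :: s) w i = w k.+2 * Vsum k.
  rewrite big_distrr big_seq [RHS]big_seq; apply: eq_bigr => s.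
  rewrite in_Vset => sV; have [hs sh _] := inV_bounds sV.
  rewrite g_cons // (_ : k.+2%:Z - 1 = k%:Z + 1); last by lia.
  rewrite (g_shift hs sh); [|by move: sV => /and5P[_ /and3P[]] //..|].
    by rewrite /= big_cons !mulrA commr_sign.
  by move: sV => /and5P[_ _ /eqP]; lia.
have -> : (if (k %% 3 == 2)%N then 0
           else (-1) ^+ g k.+2 [:: k.+2] * \prod_(i <- [:: k.+2]) w i)
          = w k.+2 * - (sigma k.+1)%:~R.
  rewrite -mulrNz sigmaS; case: ifP => k3; rewrite ?mulr0 // big_seq1.
  rewrite rmorphXn rmorphN1 /= commr_sign g_cons // g_nil; last by lia.
  by congr (_ ^+ _ * _); lia.
rewrite !mulrDr [LHS]addrC -!addrA; congr (_ + _).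
by rewrite [RHS]addrA [RHS]addrC [in RHS](addrC (_ * Vsum k)).
Qed.

(** The induction carries two consecutive values, as the recurrence has order
    two. *)
Lemma Dsum_Vsum (k : nat) :
  Dsum k = - (sigma k)%:~R + Vsum (k%:Z - 1) + Vsum k.
Proof.
have [] // : Dsum k = - (sigma k)%:~R + Vsum (k%:Z - 1) + Vsum k /\
  Dsum k.+1 = - (sigma k.+1)%:~R + Vsum k + Vsum k.+1.
elim: k => [|k [IH IH']].
  by rewrite /Dsum /Vsum !Dset_small ?Vset_small // !big_seq_fset0 !addr0 oppr0.
split; first by rewrite IH' (_ : k.+1%:Z - 1 = k) //; lia.
rewrite Dsum_step IH IH' Vsum_step sigmaSS mulrDl mul1r.
rewrite rmorphB /= opprB !opprD opprK.
(* The terms are regrouped so that the two occurrences of [Vsum k] cancel. *)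
by rewrite [LHS](AC (4*3) (5*1*3*(4*6)*(2*7))) /= subrr addr0.
Qed.
End Continuants.

(** * The three identities *)

Theorem corollary24 (k : nat) :
  [/\ - (chi1 k)%:~R
        + \sum_(s <- Dset k)
            (-1) ^+ ((k - size s + 1) %/ 2)%N * \prod_(i <- s) (1 + b i)
      = - (sigma k)%:~R
        + \sum_(s <- Vset (k%:Z - 1))
            (-1) ^+ g (k%:Z - 1) s * \prod_(i <- s) b i
        + \sum_(s <- Vset k%:Z) (-1) ^+ g k%:Z s * \prod_(i <- s) b i
      :> ncpoly,
      - chi1 k + \sum_(s <- Dset k) (-1) ^+ ((k - size s + 1) %/ 2)%N
      = - sigma k
    & - chi1 k + sigma k
      = \sum_(s <- Vset (k%:Z - 1)) (-1) ^+ (g (k%:Z - 1) s + size s)%N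
        + \sum_(s <- Vset k%:Z) (-1) ^+ (g k%:Z s + size s)%N ].
Proof.
have V_gt0 n s : s \in Vset n -> (0 < size s)%N by rewrite in_Vset => /and5P[].
split; first exact: (Dsum_Vsum b).
- have := Dsum_Vsum (fun=> 0 : int) k.
  have V0 n : Vsum (fun=> 0 : int) n = 0.
    rewrite /Vsum big_seq big1 // => s /V_gt0 s0.
    by rewrite big_const_seq count_predT -(prednK s0) /= mul0r mulr0.
  rewrite !V0 !addr0 !intz /Dsum intz => <-; congr (_ + _).
  by apply: eq_bigr => s _; rewrite big1 ?mulr1 // => i _; rewrite addr0.
- have := Dsum_Vsum (fun=> -1 : int) k.
  have VN n : Vsum (fun=> -1 : int) n
              = \sum_(s <- Vset n) (-1) ^+ (g n s + size s)%N.
    apply: eq_bigr => s _; rewrite exprD; congr (_ * _).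
    by rewrite big_const_seq count_predT -Monoid.iteropE.
  rewrite !VN !intz /Dsum intz big_seq big1 => [|s].
    by rewrite addr0 => ->; rewrite addrC !addrA subrr add0r.
  rewrite in_Dset => /and5P[s0 _ _ _ _].
  by rewrite big_const_seq count_predT -(prednK s0) /= subrr mul0r mulr0.
Qed.
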